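(* There exists a constant $C>0$, not depending on $N$, $n$ or $w$, such that the following holds for every integer $N>100$. Let $m=(N+1)/2$ if $N$ is odd and $m=N/2$ if $N$ is even, let $x_1>x_2>\dots>x_N$ be the unique strictly decreasing solution with $x_1+\dots+x_N=0$ of the recursion $$x_{n+1}=x_n-\frac{1}{x_1+\cdots+x_n},\qquad 1\le n\le N-1,$$ let $h$ be the associated sawtooth function (see context), let $f_h$ be the unique bounded solution of the Stein equation $f'(w)-wf(w)=h(w)-\mathbb{E}h(Z)$, where $Z$ is a standard normal random variable, and let $g_h(w)=(wf_h(w))'$. If $n\ge 1$ is an integer and $w\in\mathbb{R}$ satisfies either $$x_{\lfloor m/e^3\rfloor}\le x_{n+1}<w\le x_n\qquad\text{or}\qquad -x_n\le w<-x_{n+1}\le -x_{\lfloor m/e^3\rfloor},$$ then $$|g_h(w)|\le C\left(\frac{1}{\log(m/n)}+\frac{1}{n^{2/9}}\right).$$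
   Context: It is known (McKeague and Levin) that the recursion has exactly one strictly decreasing solution with $x_1+\dots+x_N=0$; it satisfies $x_n=-x_{N+1-n}$ for $1\le n\le N$. The sawtooth function $h:\mathbb{R}\to\mathbb{R}$ associated with $x_1>\dots>x_N$ is defined, with midpoints $m_n=(x_n+x_{n+1})/2$ for $1\le n<N$, by $h(w)=0$ if $w\ge x_1$ or $w<x_N$; $h(w)=w-x_{n+1}$ if $x_{n+1}\le w<m_n$, $1\le n<N$; $h(w)=x_n-w$ if $m_n\le w<x_n$, $1\le n<N$. It is continuous and $1$-Lipschitz. The symbol $\log$ denotes the natural logarithm and $\lfloor x\rfloor$ the greatest integer at most $x$. *)

(* Defs.v *)
From HB Require Import structures.
From mathcomp Require Import all_boot all_order all_algebra.
From mathcomp Require Import all_classical all_reals all_analysis.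

Set Implicit Arguments.
Unset Strict Implicit.
Unset Printing Implicit Defensive.

Import Order.TTheory GRing.Theory Num.Theory.
Import numFieldNormedType.Exports.

Local Open Scope classical_set_scope.
Local Open Scope ring_scope.

(* A finite sequence x_1, ..., x_N of reals is a function x : nat -> R of
   which only the values at the indices 1, ..., N are meaningful. *)

(* Strict decrease forces every partial sum x_1 + ... + x_n with n < N to be
   nonzero, so the convention 0^-1 = 0 plays no role in the recursion. *)
Definition recursion_solution (R : realType) (N : nat) (x : nat -> R) : Prop :=
  [/\ forall n, (1 <= n < N)%N -> x n.+1 < x n,
      \sum_(1 <= k < N.+1) x k = 0
    & forall n, (1 <= n < N)%N ->
        x n.+1 = x n - 1 / \sum_(1 <= k < n.+1) x k].

Definition midpoint (R : realType) (x : nat -> R) (n : nat) : R :=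
  (x n + x n.+1) / 2.

(* The intervals [x_{n+1}, x_n[ are pairwise disjoint, so at most one term is
   nonzero; the clauses of the piecewise definition are sawtooth_out,
   sawtooth_left and sawtooth_right below. *)
Definition sawtooth (R : realType) (N : nat) (x : nat -> R) (w : R) : R :=
  \sum_(1 <= n < N)
    (if x n.+1 <= w < midpoint x n then w - x n.+1
     else if midpoint x n <= w < x n then x n - w
     else 0).

Section sawtooth_spec.
Variables (R : realType) (N : nat) (x : nat -> R).
Hypothesis x_decr : forall n, (1 <= n < N)%N -> x n.+1 < x n.

Let x_le i j : (1 <= i)%N -> (i <= j)%N -> (j <= N)%N -> x j <= x i.
Proof.
move=> i1; elim: j => [|j IHj]; first by rewrite leqn0 => /eqP->.
rewrite leq_eqVlt => /predU1P[->//|]; rewrite ltnS => ij jN.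
apply: (le_trans _ (IHj ij (ltnW jN))); apply/ltW/x_decr.
by rewrite (leq_trans i1 ij).
Qed.

Let mid_bounds n : (1 <= n < N)%N ->
  x n.+1 < midpoint x n /\ midpoint x n < x n.
Proof. by move=> /x_decr xn; rewrite /midpoint (addrC (x n)) !midf_lt. Qed.

Let sawtooth_term_out n w : (1 <= n < N)%N -> ~~ (x n.+1 <= w < x n) ->
  (if x n.+1 <= w < midpoint x n then w - x n.+1
   else if midpoint x n <= w < x n then x n - w else 0) = 0.
Proof.
move=> /mid_bounds[xm mx] wout; case: ifPn => [/andP[xw wm]|_].
  by rewrite xw (lt_trans wm mx) in wout.
by case: ifPn => // /andP[mw wx]; rewrite wx (ltW (lt_le_trans xm mw)) in wout.
Qed.

Let sawtooth_term n w : (1 <= n < N)%N -> x n.+1 <= w < x n ->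
  sawtooth N x w =
  if x n.+1 <= w < midpoint x n then w - x n.+1
  else if midpoint x n <= w < x n then x n - w else 0.
Proof.
move=> nN /andP[xw wx]; have [n1 nltN] := andP nN.
rewrite /sawtooth (bigD1_seq n) ?mem_index_iota ?iota_uniq //=.
rewrite big_nat_cond big1 ?addr0// => k /andP[kN kn].
have [k1 kltN] := andP kN.
apply: sawtooth_term_out => //; rewrite negb_and -ltNge -leNgt.
move: kn; rewrite neq_ltn => /orP[kn|nk]; apply/orP.
- by left; apply: (lt_le_trans wx); apply: x_le => //; exact: ltnW.
- by right; apply: (le_trans _ xw); apply: x_le => //; exact: ltnW.
Qed.

Lemma sawtooth_out w : x 1%N <= w \/ w < x N -> sawtooth N x w = 0.
Proof.
move=> wout; rewrite /sawtooth big_nat_cond big1// => n /andP[nN _].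
have [n1 nltN] := andP nN.
apply: sawtooth_term_out => //; rewrite negb_and -ltNge -leNgt; apply/orP.
case: wout => [xw|wx]; [right|left].
- by apply: le_trans xw; apply: x_le => //; exact: ltnW.
- by apply: (lt_le_trans wx); apply: x_le.
Qed.

Lemma sawtooth_left n w : (1 <= n < N)%N -> x n.+1 <= w < midpoint x n ->
  sawtooth N x w = w - x n.+1.
Proof.
move=> nN /andP[xw wm]; have [_ mx] := mid_bounds nN.
by rewrite (sawtooth_term nN) ?xw ?wm// (lt_trans wm mx).
Qed.

Lemma sawtooth_right n w : (1 <= n < N)%N -> midpoint x n <= w < x n ->
  sawtooth N x w = x n - w.
Proof.
move=> nN /andP[mw wx]; have [xm _] := mid_bounds nN.
have xw := ltW (lt_le_trans xm mw).
by rewrite (sawtooth_term nN) ?xw ?wx// mw ltNge mw.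
Qed.

End sawtooth_spec.

(* E h(Z) for Z standard normal, i.e. of law N(0, 1). *)
Definition normal_mean (R : realType) (h : R -> R) : R :=
  fine 'E_(normal_prob 0 1)[h].

Definition bounded_stein_solution (R : realType) (h f : R -> R) : Prop :=
  [/\ forall w, derivable f w 1,
      forall w, f^`()%classic w - w * f w = h w - normal_mean h
    & exists M : R, forall w, `|f w| <= M].

(* Main.v *)
(* Write S_k = x_1 + ... + x_k and c = E h(Z).  From x_k - x_(k+1) = 1/S_k one
   gets that x_k^2/2 + log S_k is nonincreasing on the first half of the
   indices, which with S_m >= 2m/3 and S_n <= n (x_n + m/S_m) yields
   x_n^2 >= log(m/n)/2 when n <= m/e^3.  The Stein equation gives
   g_h(w) = (1 + w^2) f(w) + w (h(w) - c), so it remains to bound f.  Since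
   (e^(-t^2/2) f)' = e^(-t^2/2) (h - c) and f is bounded, comparison with
   e^(-t^2/2) c/t gives f(w) <= c/w, while comparison with
   e^(-t^2/2) c t/(1 + t^2), summing the error terms gap by gap and using the
   potential above, gives
   f(w) >= c w/(1 + w^2) - (1/S_n) sum_(i <= n) 1/S_i.
   With S_i >= i w and c <= 1/(2 x_1) the errors are of order 1/w^2 and
   (1/n) sum_(i <= n) 1/i <= 2 n^(-1/2).  Negative w reduce to positive w because
   x_(N+1-k) = - x_k, by uniqueness of the solution of the recursion. *)
Require Import Defs.
From HB Require Import structures.
From mathcomp Require Import all_boot all_order all_algebra.
From mathcomp Require Import all_classical all_reals all_analysis.
From mathcomp Require Import ring lra zify.

Set Implicit Arguments.
Unset Strict Implicit.
Unset Printing Implicit Defensive.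

Import Order.TTheory GRing.Theory Num.Theory.
Import numFieldNormedType.Exports.

Local Open Scope classical_set_scope.
Local Open Scope ring_scope.

Definition psum (R : realType) (x : nat -> R) (k : nat) : R :=
  \sum_(1 <= i < k.+1) x i.

Lemma psum0 (R : realType) (x : nat -> R) : psum x 0 = 0.
Proof. by rewrite /psum big_geq. Qed.

Lemma psumS (R : realType) (x : nat -> R) k :
  psum x k.+1 = psum x k + x k.+1.
Proof. by rewrite /psum big_nat_recr. Qed.

Lemma psum1 (R : realType) (x : nat -> R) : psum x 1 = x 1%N.
Proof. by rewrite psumS psum0 add0r. Qed.

Section Recursion.
Variables (R : realType) (N : nat) (x : nat -> R).
Hypothesis xP : recursion_solution N x.

Lemma recursion_ltS n : (1 <= n < N)%N -> x n.+1 < x n.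
Proof. by case: xP => + _ _; exact. Qed.

Lemma recursion_sum0 : psum x N = 0.
Proof. by case: xP. Qed.

Lemma recursion_gap n : (1 <= n < N)%N -> x n - x n.+1 = (psum x n)^-1.
Proof. by case: xP => _ _ + nN => ->//; rewrite div1r; lra. Qed.

Lemma psum_gt0 n : (1 <= n < N)%N -> 0 < psum x n.
Proof.
by move=> nN; rewrite -invr_gt0 -recursion_gap// subr_gt0 recursion_ltS.
Qed.

Lemma recursion_le i j : (1 <= i)%N -> (i <= j)%N -> (j <= N)%N -> x j <= x i.
Proof.
move=> i1; elim: j => [|j IHj]; first by lia.
rewrite leq_eqVlt => /predU1P[->//|]; rewrite ltnS => ij jN.
by apply: le_trans (IHj ij (ltnW jN)); apply/ltW/recursion_ltS; lia.
Qed.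

Lemma recursion_lt i j : (1 <= i)%N -> (i < j)%N -> (j <= N)%N -> x j < x i.
Proof.
move=> i1 ij jN; apply: (@le_lt_trans _ _ (x i.+1)).
  exact: recursion_le.
by apply: recursion_ltS; lia.
Qed.

Lemma psum_rev n : (n <= N)%N ->
  psum (fun k => - x (N.+1 - k)%N) n = psum x (N - n).
Proof.
elim: n => [_|n IHn nN]; first by rewrite psum0 subn0 recursion_sum0.
rewrite psumS IHn; last exact: ltnW.
have -> : (N - n = (N - n.+1).+1)%N by lia.
by rewrite psumS subSS (_ : (N - n = (N - n.+1).+1)%N); [lra|lia].
Qed.

Lemma recursion_rev : recursion_solution N (fun k => - x (N.+1 - k)%N).
Proof.
split.
- move=> n nN; rewrite ltrN2.
  have -> : (N.+1 - n = (N - n).+1)%N by lia.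
  by rewrite subSS; apply: recursion_ltS; lia.
- by rewrite -/(psum _ N) psum_rev// subnn psum0.
- move=> n nN; rewrite -/(psum _ n) psum_rev; last by lia.
  have -> : (N.+1 - n = (N - n).+1)%N by lia.
  by rewrite subSS div1r -recursion_gap; [lra|lia].
Qed.

End Recursion.

Lemma recursion_first_le (R : realType) (N : nat) (x y : nat -> R) :
  (0 < N)%N -> recursion_solution N x -> recursion_solution N y ->
  x 1%N <= y 1%N.
Proof.
move=> N0 xP yP; rewrite leNgt; apply/negP => yx.
suff H k : (1 <= k <= N)%N -> y k < x k /\ psum y k < psum x k.
  have [] := H N; first by rewrite N0 /=.
  by rewrite (recursion_sum0 xP) (recursion_sum0 yP) ltxx.
elim: k => [//|[_ _|k IHk kN]]; first by rewrite !psum1.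
have [|yxk Syx] := IHk; first by lia.
have kN' : (1 <= k.+1 < N)%N by lia.
have := recursion_gap xP kN'; have := recursion_gap yP kN'.
have Sy0 := psum_gt0 yP kN'; have Sx0 := psum_gt0 xP kN'.
have : (psum x k.+1)^-1 < (psum y k.+1)^-1 by rewrite ltf_pV2.
by rewrite !(psumS _ k.+1) => *; split; lra.
Qed.

Lemma recursion_uniq (R : realType) (N : nat) (x y : nat -> R) :
  (0 < N)%N -> recursion_solution N x -> recursion_solution N y ->
  forall k, (1 <= k <= N)%N -> x k = y k /\ psum x k = psum y k.
Proof.
move=> N0 xP yP.
have xy1 : x 1%N = y 1%N.
  by apply/le_anti; rewrite !(@recursion_first_le _ N).
elim=> [//|[_ _|k IHk kN]]; first by rewrite !psum1.
have [|xyk Sxy] := IHk; first by lia.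
have kN' : (1 <= k.+1 < N)%N by lia.
have := recursion_gap xP kN'; have := recursion_gap yP kN'.
by rewrite !(psumS _ k.+1) Sxy xyk => *; split; lra.
Qed.

Section Symmetry.
Variables (R : realType) (N : nat) (x : nat -> R).
Hypothesis xP : recursion_solution N x.

Lemma recursion_sym k : (1 <= k <= N)%N -> x (N.+1 - k)%N = - x k.
Proof.
move=> kN; have N0 : (0 < N)%N by lia.
have [-> _] := recursion_uniq N0 xP (recursion_rev xP) kN.
by rewrite opprK.
Qed.

Lemma psum_sym k : (1 <= k < N)%N -> psum x (N - k) = psum x k.
Proof.
move=> kN; have N0 : (0 < N)%N by lia.
have [|_ ->] := @recursion_uniq _ _ _ _ N0 xP (recursion_rev xP) k.
  by lia.
by rewrite psum_rev//; lia.
Qed.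

Lemma recursion_half_ge0 k : (1 <= k)%N -> (k.*2 <= N.+1)%N -> 0 <= x k.
Proof.
move=> k1 kN.
have : x (N.+1 - k)%N <= x k by apply: (recursion_le xP); lia.
by rewrite recursion_sym; [lra|lia].
Qed.

Lemma recursion_first_le_psum k : (1 <= k < N)%N -> x 1%N <= psum x k.
Proof.
wlog kN2 : k / (k.*2 <= N.+1)%N => [hwlog kN|].
  have [|kN2] := leqP k.*2 N.+1; first by move=> ?; exact: hwlog.
  by rewrite -psum_sym//; apply: hwlog; lia.
elim: k kN2 => [//|[_ _ _|k IHk kN2 kN]]; first by rewrite psum1.
rewrite psumS ler_wpDr//; first by apply: recursion_half_ge0.
by apply: IHk; lia.
Qed.

End Symmetry.

Definition gauss (R : realType) (t : R) : R := expR (- (t ^+ 2 / 2)).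

Section HalfRange.
Variables (R : realType) (N : nat) (x : nat -> R) (m : nat).
Hypothesis xP : recursion_solution N x.
Hypothesis mN : (m.*2 <= N.+1)%N.

Lemma psum_half_le i j : (i <= j)%N -> (j <= m)%N -> psum x i <= psum x j.
Proof.
elim: j => [|j IHj]; first by rewrite leqn0 => /eqP->.
rewrite leq_eqVlt => /predU1P[->//|]; rewrite ltnS => ij jm.
apply: le_trans (IHj ij (ltnW jm)) _; rewrite psumS lerDl.
by apply: (recursion_half_ge0 xP); lia.
Qed.

Lemma mul_le_psum j k : (j <= k)%N -> (k <= N)%N -> j%:R * x k <= psum x j.
Proof.
move=> + kN; elim: j => [|j IHj jk]; first by rewrite mul0r psum0.
rewrite psumS -natr1 mulrDl mul1r lerD ?IHj//; first exact: ltnW.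
exact: (recursion_le xP).
Qed.

Lemma psum_mean_le j k : (1 <= j)%N -> (j <= k)%N -> (k <= N)%N ->
  j%:R * psum x k <= k%:R * psum x j.
Proof.
move=> j1; elim: k => [|k IHk]; first by lia.
rewrite leq_eqVlt => /predU1P[->//|]; rewrite ltnS => jk kN.
have := IHk jk (ltnW kN); have := @mul_le_psum j k.+1 (leqW jk) kN.
by rewrite psumS -natr1; lra.
Qed.

Lemma psum_excessS k : (1 <= k < N)%N ->
  psum x k.+1 - k.+1%:R * x k.+1
  = psum x k - k%:R * x k + k%:R / psum x k.
Proof.
by move=> kN; rewrite -(recursion_gap xP kN) psumS -natr1; ring.
Qed.

Hypothesis m9 : (9 <= m)%N.

Lemma psum_half_gt0 k : (1 <= k <= m)%N -> 0 < psum x k.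
Proof. by move=> km; apply: (psum_gt0 xP); lia. Qed.

Lemma psum_excess_le k : (1 <= k <= m)%N ->
  psum x k - k%:R * x k <= k%:R * (m%:R / psum x m).
Proof.
have Sm : 0 < psum x m by apply: psum_half_gt0; lia.
elim: k => [//|[_ _|k IHk km]].
  by rewrite psum1 !mul1r subrr divr_ge0// ltW.
have Sk : 0 < psum x k.+1 by apply: psum_half_gt0; lia.
rewrite psum_excessS; last by lia.
rewrite -(natr1 k.+1) mulrDl mul1r lerD ?IHk//; first by lia.
rewrite ler_pdivrMr// mulrAC ler_pdivlMr//.
by apply: psum_mean_le; lia.
Qed.

Lemma psum_excess_ge k : (1 <= k <= m)%N ->
  k%:R * (k%:R - 1) / 2 / psum x m <= psum x k - k%:R * x k.
Proof.
have Sm : 0 < psum x m by apply: psum_half_gt0; lia.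
elim: k => [//|[_ _|k IHk km]].
  by rewrite psum1 subrr mulr0 !mul0r mul1r subrr.
have Sk : 0 < psum x k.+1 by apply: psum_half_gt0; lia.
rewrite psum_excessS; last by lia.
have {}IHk := IHk ltac:(lia).
have : k.+1%:R / psum x m <= k.+1%:R / psum x k.+1.
  by rewrite ler_pM2l// lef_pV2//; apply: psum_half_le => //; lia.
by rewrite -(natr1 k.+1); lra.
Qed.

Lemma psum_half_ge : 2 / 3 * m%:R <= psum x m.
Proof.
have Sm : 0 < psum x m by apply: psum_half_gt0; lia.
have xm : 0 <= x m by apply: (recursion_half_ge0 xP); lia.
have m9R : 9 <= m%:R :> R by rewrite (ler_nat _ 9).
have := @psum_excess_ge m ltac:(lia); rewrite ler_pdivrMr// => H.
have {}H : m%:R * (m%:R - 1) / 2 <= psum x m ^+ 2.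
  have : 0 <= m%:R * x m * psum x m by rewrite !mulr_ge0// ltW.
  by lra.
rewrite leNgt; apply/negP => Slt.
have : psum x m ^+ 2 < (2 / 3 * m%:R) ^+ 2 by rewrite ltr_pXn2r ?nnegrE// ltW.
by nra.
Qed.

(* The potential [x_k^2/2 + log S_k] is nonincreasing in [k]. *)
Lemma gauss_psum_le i j : (1 <= i)%N -> (i <= j)%N -> (j <= m)%N ->
  gauss (x i) * psum x j <= gauss (x j) * psum x i.
Proof.
move=> i1; elim: j => [|j IHj]; first by lia.
rewrite leq_eqVlt => /predU1P[->//|]; rewrite ltnS => ij jm.
have Sj : 0 < psum x j by apply: psum_half_gt0; lia.
have Si : 0 < psum x i by apply: psum_half_gt0; lia.
suff step : gauss (x j) * psum x j.+1 <= gauss (x j.+1) * psum x j.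
  rewrite -(ler_pM2r Sj); apply: (@le_trans _ _ (gauss (x j) * psum x i * psum x j.+1)).
    rewrite mulrAC; apply: ler_wpM2r; last by apply: IHj => //; exact: ltnW.
    by apply/ltW/psum_half_gt0; lia.
  by rewrite mulrAC [leRHS]mulrAC ler_pM2r.
have jN : (1 <= j < N)%N by lia.
have xj : x j = x j.+1 + (psum x j)^-1 by rewrite -(recursion_gap xP jN); lra.
have -> : gauss (x j.+1) = gauss (x j) * expR ((x j ^+ 2 - x j.+1 ^+ 2) / 2).
  by rewrite /gauss -expRD; congr expR; lra.
rewrite -mulrA ler_pM2l ?expR_gt0// psumS.
have e1 := expR_ge1Dx ((x j ^+ 2 - x j.+1 ^+ 2) / 2).
apply: le_trans (_ : (1 + (x j ^+ 2 - x j.+1 ^+ 2) / 2) * psum x j <= _).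
  have V0 : 0 < (psum x j)^-1 by rewrite invr_gt0.
  have VS : (psum x j)^-1 * psum x j = 1 by rewrite mulVf// gt_eqF.
  have -> : (1 + (x j ^+ 2 - x j.+1 ^+ 2) / 2) * psum x j =
      psum x j + ((psum x j)^-1 * psum x j) * (x j.+1 + (psum x j)^-1 / 2).
    by rewrite xj; field; rewrite gt_eqF.
  by rewrite VS; lra.
by rewrite ler_pM2r.
Qed.

Lemma recursion_sq_ge n : (1 <= n <= m)%N -> 3 <= ln (m%:R / n%:R : R) ->
  ln (m%:R / n%:R) / 2 <= x n ^+ 2.
Proof.
move=> nm; set L := ln _ => L3.
have Sm : 0 < psum x m by apply: psum_half_gt0; lia.
have xn : 0 <= x n by apply: (recursion_half_ge0 xP); lia.
have n0 : 0 < n%:R :> R by rewrite ltr0n; lia.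
have m0 : 0 < m%:R :> R by rewrite ltr0n; lia.
suff HL : L <= x n ^+ 2 / 2 + x n + 1 by nra.
rewrite -ler_expR /L lnK; last by rewrite posrE divr_gt0.
have s32 : m%:R / psum x m <= 3 / 2.
  by rewrite ler_pdivrMr//; have := psum_half_ge; lra.
have Sn : psum x n <= n%:R * (x n + 3 / 2).
  have := psum_excess_le nm.
  have : n%:R * (m%:R / psum x m) <= n%:R * (3 / 2) by rewrite ler_pM2l.
  by lra.
have g1 : gauss (x m) <= 1.
  by rewrite -expR0 ler_expR oppr_le0 divr_ge0// sqr_ge0.
have H1 : psum x m <= expR (x n ^+ 2 / 2) * psum x n.
  have := @gauss_psum_le n m ltac:(lia) ltac:(lia) (leqnn m).
  rewrite /gauss expRN mulrC ler_pdivrMr ?expR_gt0// => /le_trans; apply.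
  rewrite mulrC ler_pM2l ?expR_gt0// ler_piMl//.
  by apply/ltW/psum_half_gt0; lia.
have e1 := expR_ge1Dx (1 / 2 : R).
have e2 := expR_ge1Dx (x n + 1 / 2).
have -> : x n ^+ 2 / 2 + x n + 1 = x n ^+ 2 / 2 + ((x n + 1 / 2) + 1 / 2).
  by lra.
rewrite expRD ler_pdivrMr// expRD.
have := psum_half_ge; set e := expR _; have e0 : 0 < e := expR_gt0 _.
have : expR (x n ^+ 2 / 2) * psum x n <= e * (n%:R * (x n + 3 / 2)).
  by rewrite ler_pM2l.
have : (x n + 3 / 2) * (3 / 2) <= expR (x n + 1 / 2) * expR (1 / 2).
  by apply: ler_pM; lra.
set q := expR _ * expR _ => q1 q2 q3.
have : e * n%:R * ((x n + 3 / 2) * (3 / 2)) <= e * n%:R * q.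
  by rewrite ler_pM2l// mulr_gt0.
by lra.
Qed.

End HalfRange.

Section SteinComparison.
Variable R : realType.
Implicit Types (a b c t w : R) (f h F : R -> R).

Lemma gauss_gt0 t : 0 < gauss t.
Proof. exact: expR_gt0. Qed.

Lemma gauss_le a b : 0 <= a -> a <= b -> gauss b <= gauss a.
Proof. by move=> a0 ab; rewrite ler_expR; nra. Qed.

Lemma is_derive_gauss t : is_derive t 1 (@gauss R) (- t * gauss t).
Proof.
have d : is_derive t 1 (fun s : R => - (s ^+ 2 / 2)) (- t).
  rewrite (_ : (fun _ => _) = - ((2^-1 : R) \*: (@id R) ^+ 2)).
    apply: is_derive_eq; rewrite /= expr1 /GRing.scale /=; lra.
  by apply/funext => s; rewrite /GRing.scale/= !fctE mulrC.
have := @is_derive1_comp R expR (fun s => - (s ^+ 2 / 2)) t _ _ (is_derive_expR _) d.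
by move=> /is_derive_eq; apply; rewrite mulrC.
Qed.

Lemma mvt_le F (dF : R -> R) a b (K : R) : a <= b ->
  (forall t, t \in `[a, b] -> is_derive t 1 F (dF t)) ->
  (forall t, a < t < b -> dF t <= K) -> F b - F a <= K * (b - a).
Proof.
rewrite le_eqVlt => /predU1P[->|ab] dFP dFK; first by rewrite !subrr mulr0.
have dF_oo t : t \in `]a, b[ -> is_derive t 1 F (dF t).
  by move=> tab; apply: dFP; exact: subset_itv_oo_cc.
have cF : {within `[a, b], continuous F}.
  by apply: derivable_within_continuous => t tab; have [] := dFP t tab.
have [t tab Fab] := MVT ab dF_oo cF.
by rewrite Fab; apply: ler_wpM2r; [lra|apply: dFK; rewrite in_itv in tab].
Qed.

Lemma gauss_bounded_le0 F a (B : R) : 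
  (forall t, a <= t -> F a <= F t) ->
  (forall t, a <= t -> F t <= B * gauss t) -> F a <= 0.
Proof.
move=> Fmon FB; rewrite leNgt; apply/negP => Fa0.
pose t := `|a| + 1 + 2 * `|B| / F a.
have D0 : 0 <= 2 * `|B| / F a by rewrite divr_ge0// ?mulr_ge0// ltW.
have at_ : a <= t by have := ler_norm a; rewrite /t; lra.
have := le_trans (Fmon t at_) (FB t at_); apply/negP; rewrite -ltNge.
have t1 : 1 <= t by have := normr_ge0 a; rewrite /t; lra.
have : F a * t >= F a + 2 * `|B|.
  have -> : F a * t = F a * (`|a| + 1) + 2 * `|B|.
    by rewrite /t; field; rewrite gt_eqF.
  by have := mulr_ge0 (ltW Fa0) (normr_ge0 a); lra.
have tE : t <= 2 * expR (t ^+ 2 / 2).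
  by have := expR_ge1Dx (t ^+ 2 / 2); have := sqr_ge0 (t - 1); lra.
rewrite /gauss expRN ltr_pdivrMr ?expR_gt0//.
by have := ler_norm B; have := ler_wpM2l (ltW Fa0) tE; lra.
Qed.

Lemma is_derive_stein f h (c : R) (g : R -> R) (dg t : R) :
  is_derive t 1 f (t * f t + h t - c) -> is_derive t 1 g dg ->
  is_derive t 1 (fun s => gauss s * (f s - c * g s))
    (gauss t * (h t - c - c * dg + c * t * g t)).
Proof.
move=> df dg'.
have dG := is_derive_gauss t.
have := is_deriveM dG (is_deriveB df (is_deriveZ c dg')).
by move=> /is_derive_eq; apply; rewrite /GRing.scale/= !fctE/= /GRing.scale/=; ring.
Qed.

Lemma is_derive_inv t : t != 0 -> is_derive t 1 (@GRing.inv R) (- t ^- 2).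
Proof.
move=> t0; have := @is_deriveV R id t 1 1 t0 (is_derive_id t 1).
by move=> /is_derive_eq; apply; rewrite /GRing.scale/= mulr1.
Qed.

Lemma is_derive_mills t :
  is_derive t 1 (fun s : R => s / (1 + s ^+ 2))
    ((1 - t ^+ 2) / (1 + t ^+ 2) ^+ 2).
Proof.
have t0 : 1 + t ^+ 2 != 0 by rewrite gt_eqF//; have := sqr_ge0 t; lra.
have d : is_derive t 1 (fun s : R => 1 + s ^+ 2) (2 * t).
  rewrite (_ : (fun _ => _) = cst 1 + (@id R) ^+ 2); last exact/funext.
  have := is_deriveD (is_derive_cst (1 : R) t 1) (is_deriveX 2 (is_derive_id t 1)).
  by move=> /is_derive_eq; apply; rewrite /= expr1 add0r /GRing.scale /= mulr1.
have := is_deriveM (is_derive_id t 1)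
  (@is_deriveV R (fun s => 1 + s ^+ 2) t _ _ t0 d).
by move=> /is_derive_eq; apply; rewrite /GRing.scale/=; field.
Qed.

End SteinComparison.

Section SteinBounds.
Variables (R : realType) (f h : R -> R) (c M : R).
Hypothesis f_deriv : forall t : R, is_derive t 1 f (t * f t + h t - c).
Hypothesis f_bounded : forall t, `|f t| <= M.
Hypothesis h_ge0 : forall t, 0 <= h t.
Hypothesis c_ge0 : 0 <= c.

Lemma stein_le w : 0 < w -> f w <= c / w.
Proof.
move=> w0; pose F t := gauss t * (f t - c * t^-1).
suff : F w <= 0 by rewrite pmulr_rle0 ?gauss_gt0// subr_le0.
apply: (@gauss_bounded_le0 R F w M) => t wt; last first.
  rewrite /F mulrC ler_pM2r ?gauss_gt0//.
  have t0 : 0 < t^-1 by rewrite invr_gt0 (lt_le_trans w0).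
  have := mulr_ge0 c_ge0 (ltW t0); have := ler_norm (f t).
  by have := f_bounded t; lra.
have dF s : s \in `[w, t] ->
    is_derive s 1 (- F) (- (gauss s * (h s + c * (s^-1) ^+ 2))).
  rewrite in_itv/= => /andP[ws _].
  have s0 : s != 0 by rewrite gt_eqF// (lt_le_trans w0).
  have := is_derive_stein (f_deriv s) (is_derive_inv s0).
  move=> /is_derive_eq dF; apply: is_deriveN; apply: dF.
  by field.
have := mvt_le wt dF (K := 0).
rewrite mul0r => H; rewrite -lerN2 -subr_le0; apply: H => s _.
rewrite oppr_le0 mulr_ge0 ?(ltW (gauss_gt0 _))// addr_ge0//.
by rewrite mulr_ge0// sqr_ge0.
Qed.

(* [t / (1 + t^2)] is the classical lower bound for the Mills ratio. *)
Definition mills_excess (t : R) := gauss t * (f t - c * (t / (1 + t ^+ 2))).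

Lemma is_derive_mills_excess (t : R) :
  is_derive t 1 mills_excess (gauss t * (h t - 2 * c * ((1 + t ^+ 2)^-1) ^+ 2)).
Proof.
have t0 : 1 + t ^+ 2 != 0 by rewrite gt_eqF//; have := sqr_ge0 t; lra.
apply: is_derive_eq (is_derive_stein (f_deriv t) (is_derive_mills t)) _.
by field.
Qed.

Lemma mills_excess_tail_ge0 a : 0 <= a -> (forall t, a <= t -> h t = 0) ->
  0 <= mills_excess a.
Proof.
move=> a0 ha; rewrite -oppr_le0.
apply: (@gauss_bounded_le0 R (- mills_excess) a (M + c)) => t at_; last first.
  rewrite !fctE /mills_excess -mulrN mulrC ler_pM2r ?gauss_gt0//.
  have t2 : 0 < 1 + t ^+ 2 by have := sqr_ge0 t; lra.
  have : t / (1 + t ^+ 2) <= 1.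
    by rewrite ler_pdivrMr//; have := sqr_ge0 (t - 1); have := sqr_ge0 t; lra.
  move=> /(ler_wpM2l c_ge0); have := f_bounded t.
  by have := ler_norm (- f t); rewrite normrN; lra.
have dF s (_ : s \in `[a, t]) := is_derive_mills_excess s.
have := mvt_le at_ dF (K := 0).
rewrite mul0r => H; rewrite lerN2 -subr_le0; apply: H => s /andP[as_ _].
rewrite (ha s (ltW as_)) sub0r mulrN oppr_le0.
rewrite mulr_ge0 ?(ltW (gauss_gt0 _))//.
exact: mulr_ge0 (mulr_ge0 (ler0n _ _) c_ge0) (sqr_ge0 _).
Qed.

Lemma mills_excess_step a b B : 0 <= a -> a <= b -> 0 <= B ->
  (forall t, a < t < b -> h t <= B) ->
  mills_excess b - mills_excess a <= gauss a * B * (b - a).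
Proof.
move=> a0 ab B0 hB.
have dF s (_ : s \in `[a, b]) := is_derive_mills_excess s.
apply: (mvt_le ab dF) => t /andP[at_ tb].
have h1 : h t - 2 * c * ((1 + t ^+ 2)^-1) ^+ 2 <= B.
  have := mulr_ge0 (mulr_ge0 (ler0n _ 2) c_ge0) (sqr_ge0 (1 + t ^+ 2)^-1).
  by have := hB t; rewrite at_ tb => /(_ erefl); lra.
apply: le_trans (_ : gauss t * B <= _).
  by rewrite ler_pM2l ?gauss_gt0.
by rewrite ler_wpM2r// gauss_le// ltW.
Qed.

End SteinBounds.

Section SawtoothBounds.
Variables (R : realType) (N : nat) (x : nat -> R) (m : nat).
Hypothesis xP : recursion_solution N x.
Hypothesis mN : (m.*2 <= N.+1)%N.
Hypothesis m9 : (9 <= m)%N.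
Variables (f h : R -> R) (c M : R).
Hypothesis f_deriv : forall t : R, is_derive t 1 f (t * f t + h t - c).
Hypothesis f_bounded : forall t, `|f t| <= M.
Hypothesis c_ge0 : 0 <= c.
Hypothesis h_out : forall t : R, x 1%N <= t -> h t = 0.
Hypothesis h_gap : forall k (t : R), (1 <= k < N)%N -> x k.+1 <= t <= x k ->
  h t <= (2 * psum x k)^-1.

Lemma mills_excess_node_ge k : (1 <= k <= m)%N ->
  - (gauss (x k) / psum x k * \sum_(1 <= i < k) (psum x i)^-1)
  <= mills_excess f c (x k).
Proof.
elim: k => [//|[_ _|k IHk km]].
  rewrite big_geq// mulr0 oppr0.
  apply: (@mills_excess_tail_ge0 _ f h c M) => //.
  by apply: (recursion_half_ge0 xP); lia.
have {}IHk := IHk ltac:(lia).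
have kN : (1 <= k.+1 < N)%N by lia.
have Sk : 0 < psum x k.+1 by apply: (psum_gt0 xP).
have Sk1 : 0 < psum x k.+2 by apply: (psum_gt0 xP); lia.
have x0 : 0 <= x k.+2 by apply: (recursion_half_ge0 xP); lia.
have xlt := recursion_ltS xP kN.
have step : mills_excess f c (x k.+1) - mills_excess f c (x k.+2) <=
    gauss (x k.+2) * (2 * psum x k.+1)^-1 * (x k.+1 - x k.+2).
  apply: (mills_excess_step f_deriv) => //; first exact: ltW.
  - by rewrite invr_ge0 mulr_ge0// ltW.
  - by move=> t /andP[t1 t2]; apply: h_gap; rewrite ?(ltW t1) ?(ltW t2).
rewrite big_nat_recr//=; set s := \sum_(1 <= i < k.+1) _ in IHk *.
have s0 : 0 <= s.
  rewrite /s big_nat_cond sumr_ge0// => i; rewrite andbT => ik.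
  by rewrite invr_ge0 ltW// (psum_gt0 xP)//; lia.
have mono : gauss (x k.+1) / psum x k.+1 <= gauss (x k.+2) / psum x k.+2.
  rewrite ler_pdivrMr// mulrAC ler_pdivlMr//.
  by apply: (gauss_psum_le xP mN m9); lia.
have {mono}H1 := ler_wpM2r s0 mono.
have H2 : gauss (x k.+2) * (2 * psum x k.+1)^-1 * (x k.+1 - x k.+2) <=
    gauss (x k.+2) / psum x k.+2 / psum x k.+1.
  rewrite (recursion_gap xP kN); rewrite -!mulrA ler_pM2l ?gauss_gt0//.
  rewrite ler_pM2r ?invr_gt0// lef_pV2 ?posrE// ?mulr_gt0//.
  have := mul_le_psum xP (leqnn k.+1) ltac:(lia).
  have : 0 <= k%:R * x k.+1 by rewrite mulr_ge0//; lra.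
  by rewrite (psumS x k.+1) -(natr1 k); lra.
by rewrite mulrDr; lra.
Qed.

Lemma stein_gap_ge n w : (1 <= n)%N -> (n.+1 <= m)%N -> 0 < w ->
  x n.+1 < w <= x n ->
  c * (w / (1 + w ^+ 2)) - (psum x n)^-1 * \sum_(1 <= i < n.+1) (psum x i)^-1
  <= f w.
Proof.
move=> n1 nm w0 /andP[xw wx].
have nN : (1 <= n < N)%N by lia.
have Sn : 0 < psum x n by apply: (psum_gt0 xP).
have node := @mills_excess_node_ge n ltac:(lia).
have step : mills_excess f c (x n) - mills_excess f c w <=
    gauss w * (2 * psum x n)^-1 * (x n - w).
  apply: (mills_excess_step f_deriv) => //; first exact: ltW.
  - by rewrite invr_ge0 mulr_ge0// ltW.
  - move=> t /andP[t1 t2]; apply: h_gap => //.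
    by rewrite (ltW t2) (ltW (lt_trans xw t1)).
rewrite big_nat_recr//=; set s := \sum_(1 <= i < n) _ in node *.
have s0 : 0 <= s.
  rewrite /s big_nat_cond sumr_ge0// => i; rewrite andbT => ik.
  by rewrite invr_ge0 ltW// (psum_gt0 xP)//; lia.
have V0 : 0 < (psum x n)^-1 by rewrite invr_gt0.
have H1 : gauss (x n) / psum x n * s <= gauss w / psum x n * s.
  by rewrite ler_wpM2r// ler_wpM2r// ?gauss_le// ltW.
have H2 : gauss w * (2 * psum x n)^-1 * (x n - w) <=
    gauss w / psum x n / psum x n.
  rewrite -!mulrA ler_pM2l ?gauss_gt0//.
  have xnw : x n - w <= (psum x n)^-1 by rewrite -(recursion_gap xP nN); lra.
  rewrite invfM; apply: ler_pM => //; [|lra|lra].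
  by rewrite mulr_ge0// ?invr_ge0// ltW.
have : gauss w * (- ((psum x n)^-1 * (s + (psum x n)^-1))) <=
    gauss w * (f w - c * (w / (1 + w ^+ 2))).
  by rewrite -/(mills_excess f c w) mulrN mulrDr; lra.
by rewrite ler_pM2l ?gauss_gt0//; lra.
Qed.

End SawtoothBounds.

Lemma harmonic_le_sqrt (R : realType) (n : nat) :
  \sum_(1 <= i < n.+1) (i%:R : R)^-1 <= 2 * Num.sqrt n%:R.
Proof.
elim: n => [|n IHn]; first by rewrite big_geq// mulr_ge0// sqrtr_ge0.
rewrite big_nat_recr//=.
set s := \sum_(1 <= i < n.+1) _ in IHn *.
have a0 := sqrtr_ge0 (n%:R : R); have b0 := sqrtr_ge0 (n.+1%:R : R).
have aE : Num.sqrt n%:R ^+ 2 = n%:R :> R by rewrite sqr_sqrtr.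
have bE : Num.sqrt n.+1%:R ^+ 2 = n%:R + 1 :> R by rewrite sqr_sqrtr// natr1.
have n0 := ler0n R n.
move: IHn a0 b0 aE bE; rewrite -(natr1 n).
set a := Num.sqrt n%:R; set b := Num.sqrt (n%:R + 1) => IHn a0 b0 aE bE.
have b1 : 1 <= b by rewrite leNgt; apply/negP => blt; nra.
apply: le_trans (lerD IHn (_ : _ <= b^-1)) _.
  by rewrite lef_pV2 ?posrE; nra.
have ab : 1 <= b * (2 * (b - a)).
  have := sqr_ge0 (b - a); nra.
by have : b^-1 <= 2 * (b - a); [rewrite -[b^-1]mul1r ler_pdivrMr; nra|lra].
Qed.

Section SawtoothProperties.
Variables (R : realType) (N : nat) (x : nat -> R).
Hypothesis xP : recursion_solution N x.

Lemma sawtooth_ge0 t : 0 <= sawtooth N x t.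
Proof.
rewrite /sawtooth; apply: sumr_ge0 => n _.
by case: ifP => [/andP[? _]|_]; [|case: ifP => [/andP[_ ?]|//]]; lra.
Qed.

Lemma sawtooth_gap_le k t : (1 <= k < N)%N -> x k.+1 <= t <= x k ->
  sawtooth N x t <= (2 * psum x k)^-1.
Proof.
move=> kN /andP[xt tx].
have gap := recursion_gap xP kN.
have V0 : 0 < (psum x k)^-1 by rewrite invr_gt0 (psum_gt0 xP).
rewrite invfM; have decr := recursion_ltS xP.
move: tx; rewrite le_eqVlt => /predU1P[tE|tx].
  suff -> : sawtooth N x t = 0 by lra.
  case: k kN xt gap V0 tE => [//|[|k]] kN xt gap V0 tE.
    by apply: sawtooth_out => //; left; rewrite tE.
  have kN' : (1 <= k.+1 < N)%N by lia.
  rewrite (sawtooth_left decr kN'); first by rewrite tE subrr.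
  by rewrite tE lexx /midpoint; have := decr _ kN'; lra.
have [tm|mt] := ltP t (midpoint x k).
  by rewrite (sawtooth_left decr kN) ?xt//; move: tm; rewrite /midpoint; lra.
by rewrite (sawtooth_right decr kN) ?mt//; move: mt; rewrite /midpoint; lra.
Qed.

Lemma recursion_bracket j t : (j <= N)%N -> t < x 1%N -> x j <= t ->
  (1 <= j)%N -> exists2 k, (1 <= k < N)%N & x k.+1 <= t <= x k.
Proof.
move=> jN tx1 + j1; elim: j j1 jN => [//|[_ _ _|j IHj _ jN xt]].
  by rewrite leNgt tx1.
have [tx|xt'] := leP t (x j.+1); first by exists j.+1; [lia|rewrite xt tx].
by apply: IHj => //; [lia|exact: ltW].
Qed.

Lemma sawtooth_le_first t : (1 < N)%N -> sawtooth N x t <= (2 * x 1%N)^-1.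
Proof.
move=> N1; have x1 : 0 < x 1%N by rewrite -psum1; exact: (psum_gt0 xP).
have decr := recursion_ltS xP.
have [x1t|tx1] := leP (x 1%N) t.
  by rewrite sawtooth_out// ?invr_ge0; [lra|left].
have [txN|xNt] := ltP t (x N).
  by rewrite sawtooth_out// ?invr_ge0; [lra|right].
have [k kN xkt] := recursion_bracket (leqnn N) tx1 xNt (ltnW N1).
apply: le_trans (sawtooth_gap_le kN xkt) _.
have x1S := recursion_first_le_psum xP kN.
by rewrite lef_pV2 ?posrE; lra.
Qed.

Lemma measurable_sawtooth : measurable_fun setT (sawtooth N x).
Proof.
apply: measurable_sum => n; apply: measurable_fun_ifT.
- apply: measurable_and; first exact: measurable_realfun.measurable_fun_ler.
  exact: measurable_realfun.measurable_fun_ltr.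
- exact: measurable_realfun.measurable_funB.
apply: measurable_fun_ifT => //; last exact: measurable_realfun.measurable_funB.
apply: measurable_and; first exact: measurable_realfun.measurable_fun_ler.
exact: measurable_realfun.measurable_fun_ltr.
Qed.

End SawtoothProperties.

Lemma normal_mean_bounds (R : realType) (h : R -> R) (B : R) :
  measurable_fun setT h -> (forall t, 0 <= h t <= B) ->
  0 <= normal_mean h <= B.
Proof.
move=> mh hB.
have h0 t : 0 <= h t by have /andP[] := hB t.
have B0 : 0 <= B by have /andP[] := hB 0; exact: le_trans.
have E0 : (0 <= 'E_(normal_prob 0 1)[h])%E by exact: expectation_ge0.
have EB : ('E_(normal_prob 0 1)[h] <= B%:E)%E.
  rewrite -(expectation_cst (normal_prob 0 1) B); apply: expectation_le => //.
  by apply: aeW => t; have /andP[] := hB t.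
rewrite /normal_mean; move: E0 EB.
by case: ('E_ _ [_])%E => [r| |]//=; rewrite !lee_fin => -> ->.
Qed.

Section MainBound.
Variables (R : realType) (N : nat) (x : nat -> R) (m : nat).
Hypothesis xP : recursion_solution N x.
Hypothesis mN : (m.*2 <= N.+1)%N.
Hypothesis m9 : (9 <= m)%N.
Variables (f h : R -> R) (c M : R).
Hypothesis f_deriv : forall t : R, is_derive t 1 f (t * f t + h t - c).
Hypothesis f_bounded : forall t, `|f t| <= M.
Hypothesis h_ge0 : forall t, 0 <= h t.
Hypothesis h_out : forall t : R, x 1%N <= t -> h t = 0.
Hypothesis h_gap : forall k (t : R), (1 <= k < N)%N -> x k.+1 <= t <= x k ->
  h t <= (2 * psum x k)^-1.
Hypothesis c_bounds : 0 <= c <= (2 * x 1%N)^-1.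

Lemma stein_gap_bound n w : (1 <= n)%N -> n.+1%:R * expR 3 <= m%:R :> R ->
  x n.+1 < w <= x n ->
  `|f w + w * (w * f w + h w - c)| <=
    4 * (1 / ln (m%:R / n%:R) + 1 / n%:R `^ (2 / 9)).
Proof.
move=> n1 ne xw; have /andP[c0 cx] := c_bounds; have /andP[xw1 xw2] := xw.
have n0 : 0 < n%:R :> R by rewrite ltr0n.
have n1R : 1 <= n%:R :> R by rewrite (ler_nat _ 1).
have n0' : 0 < n.+1%:R :> R by rewrite ltr0n.
have m0 : 0 < m%:R :> R by rewrite ltr0n (leq_trans _ m9).
have e3 : 1 <= expR 3 :> R by have := expR_ge1Dx (3 : R); lra.
have nm : (n.+1 <= m)%N.
  by rewrite -(ler_nat R); apply: le_trans ne; rewrite ler_peMr// ltW.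
have nN : (1 <= n < N)%N by move: n1 nm m9 mN; clear; lia.
have nN' : (n <= N)%N by case/andP: nN => _ /ltnW.
have nmN : (n.+1.*2 <= N.+1)%N by apply: leq_trans mN; rewrite leq_double.
have L3 : 3 <= ln (m%:R / n.+1%:R : R).
  rewrite -(expRK 3) ler_ln ?posrE ?expR_gt0 ?divr_gt0//.
  by rewrite ler_pdivlMr// mulrC.
have xsq := recursion_sq_ge xP mN m9 (n := n.+1) nm L3.
have L1 : ln (m%:R / n%:R : R) <= ln (m%:R / n.+1%:R) + 1.
  have -> : m%:R / n%:R = (m%:R / n.+1%:R) * (1 + n%:R^-1) :> R.
    by rewrite -(natr1 n); field; rewrite natr1 !gt_eqF.
  rewrite lnM ?posrE ?divr_gt0 ?addr_gt0 ?invr_gt0// lerD2l.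
  have nV : 0 < n%:R^-1 :> R by rewrite invr_gt0.
  apply: le_trans (le_ln1Dx _) _; first lra.
  by rewrite invf_le1.
have x0 : 0 <= x n.+1 by exact: (recursion_half_ge0 xP).
have w0 : 0 < w by lra.
have w2 : x n.+1 ^+ 2 <= w ^+ 2 by rewrite ler_pXn2r ?nnegrE// ltW.
set L := ln (m%:R / n%:R) in L1 *; set L' := ln _ in L3 xsq L1.
have L0 : 0 < L.
  by rewrite /L ln_gt0// ltr_pdivlMr// mul1r ltr_nat.
have Sn : n%:R * w <= psum x n.
  apply: le_trans (mul_le_psum xP (leqnn n) nN').
  by rewrite ler_pM2l.
have nw0 : 0 < n%:R * w by rewrite mulr_gt0.
have x1 : w <= x 1%N.
  by apply: (le_trans xw2); exact: (recursion_le xP).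
set P := n%:R `^ (2 / 9).
have P1 : 1 <= P.
  by rewrite -(powRr0 n%:R) ler_powR//; lra.
have PS : P <= Num.sqrt n%:R.
  by rewrite -powR12_sqrt ?(ltW n0)// ler_powR//; lra.
have S1 : 1 <= Num.sqrt n%:R :> R by rewrite (le_trans P1).
have SS : Num.sqrt n%:R ^+ 2 = n%:R :> R by rewrite sqr_sqrtr// (ltW n0).
have up : f w <= c / w := stein_le f_deriv f_bounded h_ge0 c0 w0.
have lo := stein_gap_ge xP mN m9 f_deriv f_bounded c0 h_out h_gap
  n1 nm w0 xw.
have wh : w * h w <= 1 / P.
  have : h w <= (2 * psum x n)^-1 by apply: h_gap; rewrite ?(ltW xw1).
  move=> hw; apply: le_trans (_ : w * (n%:R * w)^-1 <= _).
    rewrite ler_pM2l//; apply: le_trans hw _.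
    by rewrite lef_pV2 ?posrE//; lra.
  have -> : w * (n%:R * w)^-1 = n%:R^-1 by field; rewrite !gt_eqF.
  by rewrite div1r lef_pV2 ?posrE//; nra.
have cw : c / w <= 4 / L.
  apply: le_trans (_ : (2 * w)^-1 / w <= _).
    rewrite ler_pM2r ?invr_gt0//; apply: le_trans cx _.
    by rewrite lef_pV2 ?posrE; lra.
  have -> : (2 * w)^-1 / w = (2 * w ^+ 2)^-1 by field; rewrite gt_eqF.
  have w20 : 0 < 2 * w ^+ 2 by lra.
  by rewrite ler_pdivlMr// mulrC ler_pdivrMr//; lra.
set u := (psum x n)^-1 * _ in lo.
have uw : (1 + w ^+ 2) * u <= 4 / P.
  have nw1 : (psum x n)^-1 <= (n%:R * w)^-1.
    by rewrite lef_pV2 ?posrE//; lra.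
  have Sw : \sum_(1 <= i < n.+1) (psum x i)^-1 <= 2 * Num.sqrt n%:R / w.
    apply: le_trans (_ : (\sum_(1 <= i < n.+1) i%:R^-1) / w <= _); last first.
      by rewrite ler_pM2r ?invr_gt0// harmonic_le_sqrt.
    rewrite mulr_suml; apply: ler_sum_nat => i /andP[i1 iN].
    have iN' : (i <= N)%N by rewrite (leq_trans _ nN').
    have i0 : 0 < i%:R :> R by rewrite ltr0n.
    have iw : i%:R * w <= psum x i.
      apply: le_trans (mul_le_psum xP (leqnn i) iN').
      rewrite ler_pM2l//; apply: (le_trans xw2).
      exact: (recursion_le xP).
    have iw0 : 0 < i%:R * w by rewrite mulr_gt0.
    by rewrite -invfM lef_pV2 ?posrE//; lra.
  have sum0 : 0 <= \sum_(1 <= i < n.+1) (psum x i)^-1.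
    rewrite big_nat_cond sumr_ge0// => i; rewrite andbT => ik.
    by rewrite invr_ge0 ltW// (psum_gt0 xP)//; move: ik nN; clear; lia.
  have Vn0 : 0 <= (psum x n)^-1 by rewrite invr_ge0; lra.
  have uu := ler_pM Vn0 sum0 nw1 Sw.
  have w21 : 0 <= 1 + w ^+ 2 by have := sqr_ge0 w; lra.
  apply: le_trans (ler_wpM2l w21 uu) _.
  apply: le_trans (_ : (2 * w ^+ 2) * ((n%:R * w)^-1 * (2 * Num.sqrt n%:R / w)) <= _).
    rewrite ler_wpM2r//; last by lra.
    by apply: le_trans uu; apply: mulr_ge0.
  rewrite -{1}SS; have -> : 2 * w ^+ 2 * ((Num.sqrt n%:R ^+ 2 * w)^-1 *
      (2 * Num.sqrt n%:R / w)) = 4 / Num.sqrt n%:R.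
    by field; rewrite !gt_eqF//; lra.
  by rewrite ler_pM2l// lef_pV2 ?posrE; lra.
have hw0 := mulr_ge0 (ltW w0) (h_ge0 w).
have w21 : 0 < 1 + w ^+ 2 by have := sqr_ge0 w; lra.
have gE : f w + w * (w * f w + h w - c) = (1 + w ^+ 2) * f w + w * h w - w * c.
  by ring.
have L4 : 0 < 4 / L by rewrite divr_gt0.
have P4 : 0 < 1 / P by rewrite divr_gt0//; lra.
have -> : 4 * (1 / L + 1 / P) = 4 / L + 4 * (1 / P) by ring.
rewrite gE ler_norml; apply/andP; split.
  have := ler_wpM2l (ltW w21) lo; rewrite mulrBr.
  have -> : (1 + w ^+ 2) * (c * (w / (1 + w ^+ 2))) = w * c.
    by field; rewrite gt_eqF.
  by lra.
have := ler_wpM2l (ltW w21) up.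
have -> : (1 + w ^+ 2) * (c / w) = c / w + w * c.
  by field; rewrite gt_eqF.
by lra.
Qed.

End MainBound.

Lemma expR3_le (R : realType) : expR 3 <= 50 :> R.
Proof.
have e0 := expR_gt0 (1 / 4 : R).
have e1 : expR (1 / 4) <= 4 / 3 :> R.
  have := expR_ge1Dx (- (1 / 4) : R).
  by rewrite expRN -[(expR _)^-1]div1r ler_pdivlMr//; lra.
have -> : 3 = 12%:R * (1 / 4) :> R by lra.
rewrite expRM_natl; apply: le_trans (_ : (4 / 3) ^+ 12 <= _); last by lra.
by rewrite ler_pXn2r// nnegrE; lra.
Qed.

Theorem lemma4p1 (R : realType) :
  exists C : R, 0 < C /\
  forall N : nat, (100 < N)%N ->
  let m : nat := if odd N then (N.+1 %/ 2)%N else (N %/ 2)%N in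
  let p : nat := Num.truncn (m%:R / expR 3 : R) in
  forall x : nat -> R, recursion_solution N x ->
  let h : R -> R := sawtooth N x in
  forall f_h : R -> R, bounded_stein_solution h f_h ->
  let g_h : R -> R := (fun w : R => w * f_h w)^`()%classic in
  forall (n : nat) (w : R),
    (1 <= n)%N -> (n.+1 <= N)%N ->
    (x p <= x n.+1 /\ x n.+1 < w <= x n) \/
    (- x n <= w < - x n.+1 /\ - x n.+1 <= - x p) ->
    `|g_h w| <= C * (1 / ln (m%:R / n%:R) + 1 / (n%:R `^ (2 / 9))).
Proof.
exists 4; split=> // N N100 m p x xP h f [df stein [M fM]] g n w n1 nN xw.
have mE : (m.*2 <= N.+1)%N by rewrite /m; case: ifP; lia.
have m50 : (50 <= m)%N by rewrite /m; case: ifP; lia.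
have m9 : (9 <= m)%N by lia.
have mp : p%:R * expR 3 <= m%:R :> R.
  by rewrite -ler_pdivlMr ?expR_gt0// /p truncn_le divr_ge0// expR_ge0.
have p0 : (0 < p)%N.
  rewrite /p truncn_gt0 ler_pdivlMr ?expR_gt0// mul1r.
  apply: le_trans (_ : 50 <= _); last by rewrite (ler_nat _ 50).
  exact: expR3_le.
have pn : (n.+1 <= p)%N.
  rewrite leqNgt; apply/negP => np; have := recursion_lt xP p0 np nN.
  by case: xw => -[]; lra.
have ne : n.+1%:R * expR 3 <= m%:R :> R.
  by apply: le_trans mp; rewrite ler_pM2r ?expR_gt0// ler_nat.
have h0 := sawtooth_ge0 N x.
have x1 : 0 < x 1%N by rewrite -psum1; apply: (psum_gt0 xP); lia.
set c := normal_mean h in stein.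
have c_bounds : 0 <= c <= (2 * x 1%N)^-1.
  apply: normal_mean_bounds; first exact: measurable_sawtooth.
  by move=> t; rewrite h0 (sawtooth_le_first xP)//; lia.
have decr := recursion_ltS xP.
have fP (t : R) : is_derive t 1 f (t * f t + h t - c).
  by apply: DeriveDef => //; rewrite -derive1E; have := stein t; lra.
have -> : g w = f w + w * (w * f w + h w - c).
  have := is_deriveM (is_derive_id w (1 : R)) (fP w).
  rewrite /g derive1E => -[_ ->]; rewrite /GRing.scale/=; ring.
have gap k (t : R) : (1 <= k < N)%N -> x k.+1 <= t <= x k -> h t <= (2 * psum x k)^-1.
  exact: sawtooth_gap_le.
case: xw => [[_ xw]|[/andP[xw wx] _]].
  apply: (stein_gap_bound xP mE m9 fP fM h0) => // t x1t.
  by rewrite /h sawtooth_out//; left.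
have xNE : x N = - x 1%N.
  by rewrite -(recursion_sym xP) ?subn1//; lia.
pose f' (t : R) := - f (- t).
have -> : f w + w * (w * f w + h w - c) =
    - (f' (- w) + - w * (- w * f' (- w) + h (- - w) - c)).
  by rewrite /f' opprK; ring.
rewrite normrN.
have f'P (t : R) : is_derive t 1 f' (t * f' t + h (- t) - c).
  have dN : is_derive t 1 (-%R : R -> R) (- 1) := is_deriveN (is_derive_id t 1).
  have := is_deriveN (@is_derive1_comp R f -%R t _ _ (fP (- t)) dN).
  by move=> /is_derive_eq; apply; rewrite /f'; ring.
apply: (@stein_gap_bound _ _ _ _ xP mE m9 f' (fun t => h (- t)) c M) => //.
- by move=> t; rewrite normrN.
- move=> t x1t; have N1 : (1 <= N.-1 < N)%N by lia.
  have [tN|Nt] := ltP (- t) (x N); first by rewrite /h sawtooth_out//; right.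
  have {Nt} -> : - t = x N by lra.
  have NE : (N.-1.+1 = N)%N by lia.
  have := decr _ N1; rewrite NE => xN.
  by rewrite /h (sawtooth_left decr N1) NE ?subrr// lexx /midpoint NE; lra.
- move=> k t kN xkt; rewrite -(psum_sym xP)//; apply: gap; first by lia.
  have := recursion_sym xP (k := k) ltac:(lia).
  have := recursion_sym xP (k := k.+1) ltac:(lia).
  have -> : (N.+1 - k = (N - k).+1)%N by lia.
  by rewrite subSS => -> ->; rewrite !lerN2 andbC.
- by rewrite ltrNr lerNl wx.
Qed.
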